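(* For every integer $r\geq1$, the set $\mathcal{T}(r)$ is finite.
   Context: For a triple $a,b,c\in\mathbb{Z}_{\geq2}\cup\{\infty\}$ with $a\leq b\leq c$ and $\frac1a+\frac1b+\frac1c-1<0$ (with $1/\infty=0$): for $s\in\mathbb{Z}_{\geq2}$ let $\lambda_s=2\cos(2\pi/s)$, set $\lambda_\infty=2$, $2\cdot\infty=\infty$; let $E=\mathbb{Q}(\lambda_a,\lambda_b,\lambda_c,\lambda_{2a}\lambda_{2b}\lambda_{2c})$, $\beta=\lambda_a+\lambda_b+\lambda_c+\lambda_{2a}\lambda_{2b}\lambda_{2c}+2$, and $A$ the quaternion algebra over $E$ with Hilbert symbol $(\lambda_b^2-4,(\lambda_b+2)(\lambda_c+2)\beta)$ (the $E$-algebra generated by the triangle group $\Delta(a,b,c)$). The arithmetic dimension $\operatorname{adim}(a,b,c)$ is the number of real places of $E$ at which $A$ splits. $\mathcal{T}(r)$ is the set of such triples $(a,b,c)$ with $a\leq b\leq c$ and $\operatorname{adim}(a,b,c)=r$. *)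

(* Defs.v *)
From HB Require Import structures.
From mathcomp Require Import all_boot all_order all_algebra.
From mathcomp Require Import ring.
From mathcomp Require Import all_classical all_reals all_analysis.

Set Implicit Arguments.
Unset Strict Implicit.
Unset Printing Implicit Defensive.

Import Order.TTheory GRing.Theory Num.Theory.

Local Open Scope card_scope.
Local Open Scope classical_set_scope.
Local Open Scope ring_scope.

(* The smallest subfield of F containing S: this is Q(S) when F has
   characteristic 0. *)
Definition subfield_gen (F : fieldType) (S : set F) : set F :=
  smallest [set K : set F | divring_closed [in K]] S.

Definition in_subfield_gen (F : fieldType) (S : set F) : {pred F} :=
  fun x => x \in subfield_gen S.

Lemma subfield_gen_closed (F : fieldType) (S : set F) :
  divring_closed (in_subfield_gen S).
Proof.
split.
- rewrite unfold_in; apply/mem_set => K [[K1 _ _] _]; exact: set_mem K1.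
- move=> x y; rewrite !unfold_in => /set_mem Hx /set_mem Hy.
  apply/mem_set => K HK; apply: set_mem.
  by have [[_ KB _] _] := HK; apply: KB; apply/mem_set; [exact: Hx|exact: Hy].
- move=> x y; rewrite !unfold_in => /set_mem Hx /set_mem Hy.
  apply/mem_set => K HK; apply: set_mem.
  by have [[_ _ KV] _] := HK; apply: KV; apply/mem_set; [exact: Hx|exact: Hy].
Qed.

HB.instance Definition _ (F : fieldType) (S : set F) :=
  GRing.isDivringClosed.Build F (in_subfield_gen S) (subfield_gen_closed S).

Record gen_field (F : fieldType) (S : set F) : Type := GenField {
  gen_field_val : F;
  _ : gen_field_val \in in_subfield_gen S
}.

Section GenField.
Variables (F : fieldType) (S : set F).
HB.instance Definition _ := [isSub for @gen_field_val F S].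
HB.instance Definition _ := [Choice of gen_field S by <:].
HB.instance Definition _ :=
  [SubChoice_isSubIntegralDomain of gen_field S by <:].
HB.instance Definition _ :=
  [SubIntegralDomain_isSubField of gen_field S by <:].
End GenField.

Lemma subfield_gen_sub (F : fieldType) (S : set F) (x : F) :
  S x -> x \in in_subfield_gen S.
Proof. by move=> Sx; rewrite unfold_in; apply/mem_set => K [_]; exact. Qed.

Definition adjoined (F : fieldType) (S : set F) (x : F) (Sx : S x) :
  gen_field S := GenField (subfield_gen_sub Sx).

(* The F-algebra with Hilbert symbol (x, y): coordinates are relative to the
   basis 1, i, j, ij, where i^2 = x, j^2 = y, ji = - ij.  It is a quaternion
   algebra when x and y are nonzero. *)
Definition quaternion (F : fieldType) (x y : F) : Type := 'rV[F]_4.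

Section Quaternion.
Variables (F : fieldType) (x y : F).
Local Notation Q := (quaternion x y).

HB.instance Definition _ := GRing.Lmodule.copy Q 'rV[F]_4.

Definition quat (p q r s : F) : Q :=
  \row_(l < 4) [:: p; q; r; s]`_l.

Definition quat_coord (u : Q) (l : nat) : F := (u : 'rV[F]_4) ord0 (inord l).

Definition quat_mul (u w : Q) : Q :=
  let u0 := quat_coord u 0 in let u1 := quat_coord u 1 in
  let u2 := quat_coord u 2 in let u3 := quat_coord u 3 in
  let w0 := quat_coord w 0 in let w1 := quat_coord w 1 in
  let w2 := quat_coord w 2 in let w3 := quat_coord w 3 in
  quat (u0 * w0 + x * (u1 * w1) + y * (u2 * w2) - x * y * (u3 * w3))
       (u0 * w1 + u1 * w0 - y * (u2 * w3) + y * (u3 * w2))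
       (u0 * w2 + u2 * w0 + x * (u1 * w3) - x * (u3 * w1))
       (u0 * w3 + u3 * w0 + u1 * w2 - u2 * w1).

Lemma quat_coordE p q r s l : (l < 4)%N ->
  quat_coord (quat p q r s) l = [:: p; q; r; s]`_l.
Proof. by move=> l4; rewrite /quat_coord mxE inordK. Qed.

Lemma quat_coordD (u w : Q) l :
  quat_coord (u + w) l = quat_coord u l + quat_coord w l.
Proof. by rewrite /quat_coord mxE. Qed.

Lemma quat_coordZ (k : F) (u : Q) l :
  quat_coord (k *: u) l = k * quat_coord u l.
Proof. by rewrite /quat_coord mxE. Qed.

Lemma quatP (u w : Q) :
  [/\ quat_coord u 0 = quat_coord w 0, quat_coord u 1 = quat_coord w 1,
      quat_coord u 2 = quat_coord w 2 & quat_coord u 3 = quat_coord w 3] ->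
  u = w.
Proof.
rewrite /quat_coord => -[h0 h1 h2 h3]; apply/rowP => l.
have -> : l = inord l by rewrite inord_val.
by case: l => -[|[|[|[|l]]]] Hl.
Qed.

Fact quat_mulA : associative quat_mul.
Proof.
move=> u v w; apply: quatP.
by rewrite /quat_mul !quat_coordE //=; split; ring.
Qed.

Fact quat_mul1r : left_id (quat 1 0 0 0) quat_mul.
Proof.
move=> u; apply: quatP.
by rewrite /quat_mul !quat_coordE //=; split; ring.
Qed.

Fact quat_mulr1 : right_id (quat 1 0 0 0) quat_mul.
Proof.
move=> u; apply: quatP.
by rewrite /quat_mul !quat_coordE //=; split; ring.
Qed.

Fact quat_mulDl : left_distributive quat_mul +%R.
Proof.
move=> u v w; apply: quatP.
by rewrite /quat_mul !quat_coordD !quat_coordE //=; split; ring.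
Qed.

Fact quat_mulDr : right_distributive quat_mul +%R.
Proof.
move=> u v w; apply: quatP.
by rewrite /quat_mul !quat_coordD !quat_coordE //=; split; ring.
Qed.

Fact quat_1_neq0 : quat 1 0 0 0 != 0.
Proof.
apply/eqP => /(congr1 (fun u : Q => quat_coord u 0)).
rewrite quat_coordE //= /quat_coord mxE => /eqP; exact/negP/oner_neq0.
Qed.

HB.instance Definition _ := GRing.Zmodule_isNzRing.Build Q
  quat_mulA quat_mul1r quat_mulr1 quat_mulDl quat_mulDr quat_1_neq0.

Fact quat_scaleAl (k : F) (u w : Q) : k *: (u * w) = (k *: u) * w.
Proof.
apply: quatP; rewrite /GRing.mul /= /quat_mul.
by rewrite !quat_coordZ !quat_coordE //=; split; ring.
Qed.

HB.instance Definition _ := GRing.Lmodule_isLalgebra.Build F Q quat_scaleAl.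

Fact quat_scaleAr (k : F) (u w : Q) : k *: (u * w) = u * (k *: w).
Proof.
apply: quatP; rewrite /GRing.mul /= /quat_mul.
by rewrite !quat_coordZ !quat_coordE //=; split; ring.
Qed.

HB.instance Definition _ := GRing.Lalgebra_isAlgebra.Build F Q quat_scaleAr.

Lemma quat_1E : 1 = quat 1 0 0 0 :> Q. Proof. by []. Qed.

Lemma quat_mulE (u w : Q) : u * w = quat_mul u w. Proof. by []. Qed.

Lemma quat_ii : quat 0 1 0 0 * quat 0 1 0 0 = x%:A :> Q.
Proof.
apply: quatP; rewrite !quat_coordZ quat_1E quat_mulE /quat_mul.
by rewrite !quat_coordE //=; split; ring.
Qed.

Lemma quat_jj : quat 0 0 1 0 * quat 0 0 1 0 = y%:A :> Q.
Proof.
apply: quatP; rewrite !quat_coordZ quat_1E quat_mulE /quat_mul.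
by rewrite !quat_coordE //=; split; ring.
Qed.

Lemma quat_ij : quat 0 1 0 0 * quat 0 0 1 0 = quat 0 0 0 1 :> Q.
Proof.
apply: quatP; rewrite quat_mulE /quat_mul.
by rewrite !quat_coordE //=; split; ring.
Qed.

Lemma quat_ji : quat 0 0 1 0 * quat 0 1 0 0 = - quat 0 0 0 1 :> Q.
Proof.
rewrite -scaleN1r; apply: quatP; rewrite !quat_coordZ quat_mulE /quat_mul.
by rewrite !quat_coordE //=; split; ring.
Qed.

End Quaternion.

Definition is_basis (F : fieldType) (V : lmodType F) (n : nat)
    (e : 'I_n -> V) : Prop :=
  bijective (fun c : 'rV[F]_n => \sum_i c ord0 i *: e i).

(* A (x)_{E,v} R is isomorphic to M_2(R) as an R-algebra.  By the universal
   property of the extension of scalars, an R-algebra morphism from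
   A (x)_{E,v} R to M_2(R) is a v-semilinear ring morphism f from A to M_2(R);
   it is bijective iff f maps an E-basis of A to an R-basis of M_2(R). *)
Definition splits_at (E R : fieldType) (A : algType E)
    (v : {rmorphism E -> R}) : Prop :=
  exists (f : {lrmorphism A -> 'M[R]_2 | v \; *:%R}) (n : nat)
         (e : 'I_n -> A),
    is_basis e /\ is_basis (f \o e).

(* Elements s of Z_{>= 2} u {oo} are encoded as s : \bar int with 2 <= s. *)

Definition hyperbolic_triple (a b c : \bar int) : Prop :=
  let inv (s : \bar int) : rat := if s is n%:E then n%:~R^-1 else 0 in
  [/\ (2%:E <= a)%E, (a <= b)%E, (b <= c)%E &
      inv a + inv b + inv c - 1 < 0].

Section Triangle.
Variable R : realType.

Definition lambda (s : \bar int) : R :=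
  if s is n%:E then 2 * cos (2 * pi / n%:~R) else 2.

Variables a b c : \bar int.

Definition lambda_prod : R :=
  lambda (2%:E * a) * lambda (2%:E * b) * lambda (2%:E * c).

Definition triangle_gens : set R :=
  [set x | [\/ x = lambda a, x = lambda b, x = lambda c | x = lambda_prod]].

Definition triangle_field : fieldType := gen_field triangle_gens.
Local Notation E := triangle_field.

Definition lambda_a : E := adjoined (Or41 _ _ _ erefl : triangle_gens _).
Definition lambda_b : E := adjoined (Or42 _ _ _ erefl : triangle_gens _).
Definition lambda_c : E := adjoined (Or43 _ _ _ erefl : triangle_gens _).
Definition lambda_2abc : E := adjoined (Or44 _ _ _ erefl : triangle_gens _).

Definition triangle_beta : E :=
  lambda_a + lambda_b + lambda_c + lambda_2abc + 2.

(* For b = oo the symbol degenerates, since lambda_b^2 - 4 = 0.  The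
   quaternion algebra generated by the triangle group is then M_2(E), because
   it contains u - 1 with u a unipotent element other than 1. *)
Definition triangle_algebra : algType E :=
  if b is _%:E
  then quaternion (lambda_b ^+ 2 - 4)
                  ((lambda_b + 2) * (lambda_c + 2) * triangle_beta)
  else 'M[E]_2.

Definition split_real_places : set {rmorphism E -> R} :=
  [set v | splits_at triangle_algebra v].

Definition adim_eq (r : nat) : Prop := split_real_places #= `I_r.

End Triangle.

Definition triangle_triples (R : realType) (r : nat) :
    set (\bar int * \bar int * \bar int) :=
  [set t | let: (a, b, c) := t in
           hyperbolic_triple a b c /\ adim_eq R a b c r].

(* Main.v *)
Require Import Defs.
From HB Require Import structures.
From mathcomp Require Import all_boot all_order all_algebra all_field.
From mathcomp Require Import all_classical all_reals all_analysis.
From mathcomp Require Import complex.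
From mathcomp Require Import zify ring lra.

(* Let v_k be the real place of E induced by zeta |-> zeta^k, with k prime to
   2abc.  In v_k the algebra has Hilbert symbol (x, y) with y a positive multiple
   of beta_k and, with A, B, C = k pi/a, k pi/b, k pi/c,
     beta_k / 4 = (cos C + cos (A + B)) (cos C + cos (A - B)),
   so the algebra splits at v_k as soon as A, B, C have the cosines of
   nonnegative angles of sum less than pi.  It remains to find r + 1 such k that
   are distinguished by one of the generators of E.
   - If c >= (2ab)^2, take k < c/6 with k = 1 mod 2ab; the angles are then
     pi/a <= pi/2, pi/b <= pi/3 and k pi/c < pi/6.
   - Otherwise, if b >= (2a)^2, take k < b/4 with k = 1 mod 2a.
   - Otherwise take k < a/3.
   In each case abc is bounded by a power of the number X of candidates k, and
   sieving yields r + 1 of them prime to abc as soon as X is large: with P the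
   product of the primes up to T ~ log X, each of the numbers 1 + m P t, t < T,
   is prime to P, a prime beyond T divides at most one of them, and an integer
   below X^D has only O(log X / log log X) such prime divisors.  Chebyshev's
   bound P <= 4^T keeps these numbers below m X.  An infinite entry counts as
   the angle 0 and contributes no condition on k. *)

Set Implicit Arguments.
Unset Strict Implicit.
Unset Printing Implicit Defensive.

Import Order.TTheory GRing.Theory Num.Theory.

(** * Integers prime to n in an arithmetic progression *)

Lemma leq_exp2rW e m n : m <= n -> m ^ e <= n ^ e.
Proof. by case: e => // e; rewrite leq_exp2r. Qed.

Lemma prod_primes_dvd (s : seq nat) (n : nat) :
  uniq s -> {in s, forall p, prime p && (p %| n)} -> \prod_(p <- s) p %| n.
Proof.
elim: s => [|p s IHs] /=; first by rewrite big_nil dvd1n.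
case/andP=> ps us Hs; rewrite big_cons Gauss_dvd.
  have /andP[_ ->] := Hs p (mem_head _ _).
  by rewrite IHs // => q qs; apply: Hs; rewrite inE qs orbT.
have /andP[pp _] := Hs p (mem_head _ _).
rewrite big_seq; elim/big_ind: _ => [|x y px py|q qs]; first exact: coprimen1.
  by rewrite coprimeMr px.
have /andP[pq _] : prime q && (q %| n) by apply: Hs; rewrite inE qs orbT.
by rewrite prime_coprime // dvdn_prime2 //; apply: contraNneq ps => ->.
Qed.

(** The two central coefficients of row [2m + 1] are equal, and their sum is at most the row sum
    [2 ^ (2m + 1) = 2 * 4 ^ m]. *)
Lemma bin_odd_center_le m : 'C(m.*2.+1, m) <= 4 ^ m.
Proof.
have : 2 ^ m.*2.+1 = \sum_(i < m.*2.+2) 'C(m.*2.+1, i).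
  by rewrite -[2]/(1 + 1) expnDn; apply: eq_bigr => i _; rewrite !exp1n !muln1.
have m1 : m < m.*2.+2 by lia.
have m2 : m.+1 < m.*2.+2 by lia.
rewrite (bigD1 (Ordinal m1)) //= (bigD1 (Ordinal m2)) /=; last first.
  by rewrite -val_eqE /=; lia.
have -> : 'C(m.*2.+1, m.+1) = 'C(m.*2.+1, m).
  by rewrite -bin_sub; [congr 'C(_, _)|]; lia.
have -> : 2 ^ m.*2.+1 = 2 * 4 ^ m by rewrite expnS -mul2n expnM.
lia.
Qed.

Definition primorial (n : nat) : nat := \prod_(1 <= p < n.+1 | prime p) p.

Lemma primorial_gt0 n : 0 < primorial n.
Proof. by rewrite prodn_cond_gt0 // => p; apply: prime_gt0. Qed.

Lemma dvdn_primorial p n : prime p -> p <= n -> p %| primorial n.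
Proof.
move=> pp pn; rewrite /primorial -big_filter (bigD1_seq p).
- exact: dvdn_mulr.
- by rewrite mem_filter mem_index_iota pp prime_gt0.
- by rewrite filter_uniq ?iota_uniq.
Qed.

(** Erdős's induction. An even [n > 2] is not prime, so [n - 1] takes over. For [n = 2m + 1], the
    primes up to [m + 1] contribute at most [4 ^ (m + 1)] by induction, and those from [m + 2] to
    [2m + 1] all divide ['C(2m + 1, m) <= 4 ^ m]. *)
Lemma primorial_le n : primorial n <= 4 ^ n.
Proof.
elim/ltn_ind: n => -[|[|[|n]]] IHn; rewrite /primorial.
- by rewrite big_nil.
- by rewrite unlock.
- by rewrite unlock.
have [odd_n|even_n] := boolP (odd n.+3); last first.
  rewrite big_mkcond big_nat_recr //= ifN ?muln1 -?big_mkcond; last first.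
    by apply: contra even_n => /even_prime[].
  by apply: leq_trans (IHn n.+2 _) _; rewrite ?leq_exp2l.
set m := n.+3./2; have Dn : n.+3 = m.*2.+1 by rewrite -[LHS]odd_double_half odd_n.
have m_gt0 : 0 < m by lia.
move: m Dn m_gt0 => m Dn m_gt0 {odd_n}.
rewrite Dn (@big_cat_nat _ _ _ m.+2) /=; [|lia|lia].
have -> : 4 ^ m.*2.+1 = 4 ^ m.+1 * 4 ^ m by rewrite -expnD; congr (_ ^ _); lia.
apply: leq_mul; first by apply: IHn; lia.
apply: leq_trans (bin_odd_center_le m); apply: dvdn_leq; first by rewrite bin_gt0; lia.
rewrite -big_filter; apply: prod_primes_dvd => [|p].
  by rewrite filter_uniq ?iota_uniq.
rewrite mem_filter mem_index_iota => /andP[pp /andP[mp pm]]; rewrite pp /=.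
have : p %| m.*2.+1`! by rewrite dvdn_fact // prime_gt0.
rewrite -(@bin_fact m.*2.+1 m); last by rewrite -addnn; lia.
have pf k : k < p -> p %| k`! = false.
  elim: k => [|k IHk] kp; first by rewrite Euclid_dvd1.
  by rewrite factS Euclid_dvdM // IHk ?(ltnW kp) // gtnNdvd.
by rewrite !Euclid_dvdM // !pf ?orbF; lia.
Qed.

Lemma large_primes_dvd_count (n T : nat) (s : seq nat) :
  0 < n -> uniq s -> {in s, forall p, [&& prime p, p %| n & T <= p]} ->
  T ^ size s <= n.
Proof.
move=> n_gt0 us Hs.
have : \prod_(p <- s) p %| n.
  by apply: prod_primes_dvd => // p /Hs/and3P[-> ->].
move/(dvdn_leq n_gt0); apply: leq_trans.
elim: s us Hs => [|p s IHs] /= us Hs; first by rewrite big_nil.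
rewrite big_cons expnS leq_mul //; first by have /and3P[] := Hs p (mem_head _ _).
by apply: IHs => [|q qs]; [case/andP: us | apply: Hs; rewrite inE qs orbT].
Qed.

(** The candidates are the [1 + M t] with [t < T]. If [b] of them share a factor with [n], then [n]
    has [b] distinct prime divisors above [T], so [2 ^ (h b) <= T ^ b <= n < 2 ^ (h (T - r))]: fewer
    than [T - r] candidates fail. *)
Lemma many_coprime_in_progression T h r n m :
  2 ^ h <= T -> 0 < n -> 0 < m -> n < 2 ^ (h * (T - r)) ->
  exists s : seq nat, [/\ uniq s, size s = r &
    {in s, forall k, [/\ k = 1 %[mod m], coprime k n & k < m * 8 ^ T]}].
Proof.
move=> hT n_gt0 m_gt0 nT; pose M := m * primorial T.
pose k t := 1 + M * t; pose d t := pdiv (gcdn (k t) n).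
have k_gt0 t : 0 < k t by [].
pose s0 := [seq t <- iota 0 T | coprime (k t) n].
pose s1 := [seq t <- iota 0 T | ~~ coprime (k t) n].
have s1P t : t \in s1 -> [/\ prime (d t), d t %| n, d t %| k t & coprime (d t) M].
  rewrite mem_filter => /andP[nc _].
  have pd : prime (d t) by apply: pdiv_prime; rewrite ltn_neqAle eq_sym nc gcdn_gt0.
  have := pdiv_dvd (gcdn (k t) n); rewrite dvdn_gcd -/(d t) => /andP[dk dn].
  split=> //; rewrite prime_coprime //; apply: contraTN dk => dM.
  by rewrite /k (dvdn_addl _ (dvdn_mulr _ dM)) (Euclid_dvd1 pd).
have d_ge t : t \in s1 -> T < d t.
  case/s1P=> pd _ _ cd; rewrite ltnNge; apply: contraL cd => dT.
  by rewrite prime_coprime // negbK dvdn_mull // dvdn_primorial.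
(* A prime dividing both [k t] and [k t'] divides [M (t' - t)]. It is coprime to [M], so it divides
   [t' - t < T], while it exceeds [T]; hence [t = t']. *)
have d_inj : {in s1 &, injective d}.
  have main t t' : t \in s1 -> t' \in s1 -> t <= t' -> d t = d t' -> t = t'.
    move=> ts ts' tt' e; have [pd _ dk cd] := s1P _ ts; have [_ _ dk' _] := s1P _ ts'.
    have : d t %| k t' - k t by rewrite dvdn_sub // e.
    rewrite /k subnDl -mulnBr Gauss_dvdr // => dt.
    have : t' < T by move: ts'; rewrite mem_filter mem_iota => /andP[].
    have := d_ge _ ts; case: (posnP (t' - t)) => [|/dvdn_leq/(_ dt)]; lia.
  move=> t t' ts ts' e; case/orP: (leq_total t t') => tt'; first exact: main.
  by apply/esym/main.
have s1_lt : size s1 < T - r.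
  have : T ^ size (map d s1) <= n.
    apply: large_primes_dvd_count => //.
      by rewrite map_inj_in_uniq // filter_uniq // iota_uniq.
    move=> _ /mapP[t ts ->]; have [-> -> _ _] := s1P _ ts.
    by rewrite ltnW // d_ge.
  rewrite size_map => Tn.
  have : 2 ^ (h * size s1) < 2 ^ (h * (T - r)).
    rewrite expnM; apply: leq_ltn_trans _ nT; apply: leq_trans _ Tn.
    exact: leq_exp2rW.
  by rewrite ltn_exp2l // ltn_mul2l => /andP[].
have s0_ge : r <= size s0.
  have : size s0 + size s1 = T by rewrite !size_filter count_predC size_iota.
  lia.
exists (map k (take r s0)); split.
- rewrite map_inj_uniq ?take_uniq ?filter_uniq ?iota_uniq // => t t' /addnI/eqP.
  by rewrite eqn_pmul2l ?muln_gt0 ?m_gt0 ?primorial_gt0 // => /eqP.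
- by rewrite size_map size_takel.
move=> _ /mapP[t /mem_take ts ->]; move: ts.
rewrite mem_filter mem_iota => /andP[ct /= tT]; split=> //.
  by rewrite /k /M addnC -mulnA mulnC modnMDl.
have := primorial_le T; have := ltn_expl T (isT : 1 < 2).
have -> : 8 ^ T = 4 ^ T * 2 ^ T by rewrite -expnMn.
rewrite /k /M; set P := primorial T; set Q := 4 ^ T; set D := 2 ^ T => TD PQ.
have : m * (P * t.+1) <= m * (Q * T) by rewrite leq_mul2l leq_mul ?orbT.
have : m * (Q * T) < m * (Q * D) by rewrite !ltn_mul2l m_gt0 TD expn_gt0.
have : 0 < m * P by rewrite muln_gt0 m_gt0 primorial_gt0.
rewrite mulnS mulnDr mulnA; lia.
Qed.

Lemma many_coprime_below D r : exists X0, forall X n m,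
  X0 <= X -> 0 < n -> 0 < m -> n <= X ^ D ->
  exists s : seq nat, [/\ uniq s, size s = r &
    {in s, forall k, [/\ k = 1 %[mod m], coprime k n & k < m * X]}].
Proof.
(* With [T = trunc_log 8 X], [n] is at most [8 ^ ((T + 1) D) = 2 ^ (3 D (T + 1))]. As [T >= 2r + 1]
   gives [T + 1 <= 2 (T - r)], the exponent is at most [6 D (T - r)], which is less than
   [h (T - r)]. *)
pose h := (6 * D).+1; pose T0 := 2 ^ h + r.*2.+1.
exists (8 ^ T0) => X n m X0X n_gt0 m_gt0 nX.
have X_gt0 : 0 < X by apply: leq_trans X0X; rewrite expn_gt0.
pose T := trunc_log 8 X.
have T0T : T0 <= T by apply: trunc_log_max.
have [| |s [us ss Hs]] := @many_coprime_in_progression T h r n m _ n_gt0 m_gt0.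
- by apply: leq_trans T0T; rewrite leq_addr.
- apply: leq_ltn_trans nX _.
  apply: (@leq_ltn_trans (8 ^ (T.+1 * D))).
    rewrite expnM; apply: leq_exp2rW; apply: ltnW; exact: trunc_log_ltn.
  rewrite -[8]/(2 ^ 3) -expnM ltn_exp2l // /h.
  have : r.*2.+1 <= T by apply: leq_trans T0T; rewrite leq_addl.
  nia.
exists s; split=> // k /Hs[-> -> kT]; split=> //.
by apply: leq_trans kT _; apply: leq_mul => //; apply: trunc_logP.
Qed.

Local Open Scope classical_set_scope.
Local Open Scope ring_scope.

Local Notation map_rat F := (map_poly (ratr : rat -> F)).

(** * Galois conjugation of cosines *)

(** [z] is a root of [X^n - 1], hence of some ['Phi_d] with [d] dividing [n]; then [z ^ d = 1], and
    primitivity forces [d = n]. *)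
Lemma root_Cyclotomic (F : numFieldType) (n : nat) (z : F) :
  n.-primitive_root z -> root (map_poly intr 'Phi_n) z.
Proof.
move=> zn; have n_gt0 := prim_order_gt0 zn.
have : root (map_poly intr (\prod_(d <- divisors n) 'Phi_d)) z.
  rewrite prod_Cyclotomic // rmorphB rmorph1 /= map_polyXn /root !hornerE.
  by rewrite prim_expr_order // subrr.
rewrite rmorph_prod /= rootE horner_prod prodf_seq_eq0 => /hasP[d].
rewrite -dvdn_divisors // => dn rd; have [<- //|ndn] := eqVneq d n.
have : root (map_poly intr ('X^d - 1 : {poly int})) z.
  have d_gt0 := dvdn_gt0 n_gt0 dn.
  rewrite -prod_Cyclotomic // rmorph_prod /= rootE horner_prod prodf_seq_eq0.
  apply/hasP; exists d => //.
  by rewrite -dvdn_divisors.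
rewrite rmorphB rmorph1 /= map_polyXn /root !hornerE subr_eq0.
by rewrite -(prim_order_dvd zn) => nd; rewrite (eqn_dvd d n) dn nd in ndn.
Qed.

(* Irreducibility of 'Phi_n over the rationals *)
Lemma Cyclotomic_dvdp (n : nat) (p : {poly rat}) : (0 < n)%N ->
  ~~ coprimep p (map_poly intr 'Phi_n) -> map_poly intr 'Phi_n %| p.
Proof.
move=> n_gt0; set Phi := map_poly _ _ => ncop.
have [w rw] : exists w, root (map_rat algC (gcdp p Phi)) w.
  by apply/closed_rootP; rewrite size_map_poly.
have rwp : root (map_rat algC p) w.
  by apply: root_dvdp rw; rewrite dvdp_map dvdp_gcdl.
have rwPhi : root (map_rat algC Phi) w.
  by apply: root_dvdp rw; rewrite dvdp_map dvdp_gcdr.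
have [z zn] := C_prim_root_exists n_gt0.
have PhiC : map_rat algC Phi = cyclotomic z n.
  rewrite -(Cintr_Cyclotomic zn) /Phi -map_poly_comp.
  by apply: eq_map_poly => i /=; rewrite ratr_int.
have wn : n.-primitive_root w by rewrite -(root_cyclotomic zn) -PhiC.
(* The minimal polynomial of the common root [w] is [Phi], and it divides every rational polynomial
   vanishing at [w]. *)
have [q [qw _ qd]] := minCpolyP w.
have <- : q = Phi.
  apply: (map_poly_inj (ratr : {rmorphism rat -> algC})).
  rewrite -qw (minCpoly_cyclotomic wn) /= PhiC -(Cintr_Cyclotomic zn).
  by rewrite (Cintr_Cyclotomic wn).
by rewrite -qd.
Qed.

(** Sharing the root [z] with the irreducible ['Phi_n], the polynomial [p] is a multiple of it. *)
Lemma conjugate_primitive_roots (F : numFieldType) (n : nat) (z w : F) (p : {poly rat}) :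
  n.-primitive_root z -> n.-primitive_root w ->
  root (map_rat F p) z -> root (map_rat F p) w.
Proof.
move=> zn wn rz; have n_gt0 := prim_order_gt0 zn.
have PhiF : map_rat F (map_poly intr 'Phi_n) = map_poly intr 'Phi_n.
  by rewrite -map_poly_comp; apply: eq_map_poly => i /=; rewrite ratr_int.
suff : map_poly intr 'Phi_n %| p.
  rewrite -(dvdp_map (ratr : {rmorphism rat -> F})) /= PhiF => /root_dvdp; apply.
  exact: root_Cyclotomic.
apply: Cyclotomic_dvdp => //; apply/negP.
rewrite -(coprimep_map (ratr : {rmorphism rat -> F})) /= PhiF.
by move/coprimep_root/(_ rz); rewrite -rootE root_Cyclotomic.
Qed.

(** * Roots of unity on the unit circle and their real parts *)

Section Cis.
Variable R : realType.
Local Open Scope complex_scope.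

Definition cis (x : R) : R[i] := cos x +i* sin x.

Lemma cisD x y : cis (x + y) = cis x * cis y.
Proof.
by apply/eqP; rewrite eq_complex /= cosD sinD (addrC (cos x * sin y)) !eqxx.
Qed.

Lemma cisX x n : cis x ^+ n = cis (n%:R * x).
Proof.
elim: n => [|n IHn]; first by rewrite mul0r /cis cos0 sin0.
by rewrite exprS IHn -cisD; congr cis; rewrite -natr1; ring.
Qed.

Lemma cis_neq1 x : 0 < x < 2 * pi -> cis x != 1.
Proof.
move=> /andP[x0 x2]; rewrite eq_complex /= negb_and; apply/orP; left.
have s0 : 0 < sin (x / 2) by apply: sin_gt0_pi; lra.
suff : cos x != 1 by [].
have -> : x = x / 2 + x / 2 by lra.
rewrite cosD; have := cos2Dsin2 (x / 2); nra.
Qed.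

Lemma cis_primitive_root (M k : nat) : (0 < M)%N -> coprime k (2 * M) ->
  (2 * M).-primitive_root (cis (k%:R * (pi / M%:R))).
Proof.
move=> M0 kM; rewrite -cisX prim_root_exp_coprime //.
rewrite /primitive_root_of_unity muln_gt0 M0; apply/forallP => i; apply/eqP.
have Mr : 0 < M%:R :> R by rewrite ltr0n.
rewrite unity_rootE cisX; case: (eqVneq i.+1 (2 * M)%N) => [->|iM].
  have -> : (2 * M)%:R * (pi / M%:R) = pi *+ 2 :> R.
    by rewrite natrM -mulr_natl; field; rewrite lt0r_neq0.
  by rewrite /cis cos2pi sin2pi eqxx.
apply/negbTE/cis_neq1.
have iM' : (i.+1 < 2 * M)%N by rewrite ltn_neqAle iM ltn_ord.
have pi0 := pi_gt0 R.
rewrite mulr_gt0 ?divr_gt0 ?ltr0n //= mulrCA mulrC ltr_pM2r //.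
by rewrite ltr_pdivrMr // -natrM ltr_nat.
Qed.

(** [2 cos x] is the sum of [cis x] and its inverse, so vanishing of [p] at it is vanishing of a
    rational polynomial at a primitive [2M]-th root of unity, and all such roots are conjugate. *)
Lemma conjugate_cos (M k : nat) (p : {poly rat}) : (0 < M)%N -> coprime k (2 * M) ->
  root (map_rat R p) (2 * cos (k%:R * (pi / M%:R))) =
  root (map_rat R p) (2 * cos (pi / M%:R)).
Proof.
move=> M0 kM.
have key j : coprime j (2 * M) ->
    root (map_rat R p) (2 * cos (j%:R * (pi / M%:R))) =
    (* the inverse of a 2M-th root of unity is its power 2M - 1 *)
    root (map_rat R[i] (p \Po ('X + 'X^((2 * M).-1)))) (cis (j%:R * (pi / M%:R))).
  move=> /(cis_primitive_root M0); set x := _ * (pi / _) => zn.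
  have -> : root (map_rat R p) (2 * cos x) = root (map_rat R[i] p) (2 * cos x)%:C.
    rewrite -(fmorph_root (real_complex R)) /= -map_poly_comp.
    by congr (root _ _); apply: eq_map_poly => c /=; rewrite fmorph_rat.
  rewrite map_comp_poly rmorphD /= map_polyXn map_polyX !rootE horner_comp !hornerE.
  congr ((map_rat _ p).[_] == 0).
  have -> : cis x ^+ (2 * M).-1 = cis (- x).
    have z0 : cis x != 0.
      apply/eqP => z0; move: (prim_expr_order zn).
      rewrite z0 expr0n -[_ == _]negbK -lt0n muln_gt0 M0 /= => /eqP.
      by rewrite eq_sym oner_eq0.
    apply: (mulfI z0); rewrite -exprS prednK ?muln_gt0 ?M0 // (prim_expr_order zn).
    by rewrite -cisD subrr /cis cos0 sin0.
  by apply/eqP; rewrite eq_complex /= cosN sinN; apply/andP; split; apply/eqP; lra.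
rewrite key // -{2}[pi / M%:R]mul1r (key 1%N) ?coprime1n //.
have c1 := cis_primitive_root M0 (coprime1n _); have ck := cis_primitive_root M0 kM.
apply/idP/idP; first exact: (conjugate_primitive_roots ck c1).
exact: (conjugate_primitive_roots c1 ck).
Qed.

End Cis.

(** * The field embedding sending an element to a conjugate *)

Section Conjugation.
Variables (F : numFieldType) (t t' : F).
Hypothesis conj_t : forall p : {poly rat}, root (map_rat F p) t' = root (map_rat F p) t.

Let ev (x : F) (p : {poly rat}) : F := (map_rat F p).[x].

Let evM x p q : ev x (p * q) = ev x p * ev x q.
Proof. by rewrite /ev rmorphM hornerM. Qed.
Let evB x p q : ev x (p - q) = ev x p - ev x q.
Proof. by rewrite /ev rmorphB !hornerE. Qed.
Let ev1 x : ev x 1 = 1.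
Proof. by rewrite /ev rmorph1 hornerC. Qed.
Let ev_eq0 p : (ev t' p == 0) = (ev t p == 0).
Proof. by rewrite /ev -!rootE conj_t. Qed.

(* Fractions, rather than polynomials, make closure under inverses immediate. *)
Let fraction (x : F) (pq : {poly rat} * {poly rat}) : Prop :=
  ev t pq.2 != 0 /\ x = ev t pq.1 / ev t pq.2.

(** This makes the embedding well defined: two fractions agree at [t] when their cross difference
    vanishes there, and this vanishing transfers to [t']. *)
Let fraction_conj x pq pq' : fraction x pq -> fraction x pq' ->
  ev t' pq.1 / ev t' pq.2 = ev t' pq'.1 / ev t' pq'.2.
Proof.
case: pq pq' => [p q] [p' q'] [/= q0 ->] [/= q0' /eqP].
rewrite eqr_div // -subr_eq0 -!evM -evB -ev_eq0 evB !evM subr_eq0 => /eqP e.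
by apply/eqP; rewrite eqr_div ?ev_eq0 //; apply/eqP.
Qed.

Let fraction_closed :
  divring_closed [in [set x | exists pq, fraction x pq]%classic].
Proof.
split.
- by apply/mem_set; exists (1, 1); split; rewrite /= ev1 ?oner_neq0 // divr1.
- move=> x y /set_mem[[p q] [/= q0 ->]] /set_mem[[p' q'] [/= q0' ->]].
  apply/mem_set; exists (p * q' - p' * q, q * q').
  by rewrite /fraction /= evB !evM mulf_neq0 //; split=> //; field; rewrite ?q0 ?q0'.
move=> x y /set_mem[[p q] [/= q0 ->]] /set_mem[[p' q'] [/= q0' ->]].
apply/mem_set; have [p0|p0] := eqVneq (ev t p') 0.
  (* The divisor is 0, so the quotient is 0 by the convention [0^-1 = 0]. *)
  exists (0, 1); split; rewrite /= ev1 ?oner_neq0 //.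
  by rewrite p0 mul0r invr0 mulr0 /ev rmorph0 horner0 mul0r.
exists (p * q', q * p').
by rewrite /fraction /= !evM mulf_neq0 //; split=> //; field; rewrite ?q0 ?q0' ?p0.
Qed.

(** The fractions in [t] form a field containing [S], hence all of [gen_field S]; the embedding
    sends [p(t) / q(t)] to [p(t') / q(t')]. *)
Lemma conjugate_embedding (S : set F) :
  (forall x, S x -> exists p, x = (map_rat F p).[t]) ->
  exists v : {rmorphism gen_field S -> F},
    forall (x : gen_field S) p, \val x = (map_rat F p).[t] -> v x = (map_rat F p).[t'].
Proof.
move=> genS.
have fracP (x : gen_field S) : exists pq, fraction (\val x) pq.
  have : subfield_gen S (\val x) by case: x => x xS; apply: set_mem; exact: xS.
  move/(_ [set y | exists pq, fraction y pq]%classic); apply.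
  split; first exact: fraction_closed.
  move=> y /genS[p ->]; exists (p, 1).
  by split; rewrite /= ev1 ?oner_neq0 // divr1.
pose v (x : gen_field S) : F :=
  let pq := projT1 (cid (fracP x)) in ev t' pq.1 / ev t' pq.2.
have vE x pq : fraction (\val x) pq -> v x = ev t' pq.1 / ev t' pq.2.
  by apply: fraction_conj; apply: (projT2 (cid (fracP x))).
have vB : zmod_morphism v.
  move=> x y; have [[p q] [/= q0 xE]] := fracP x; have [[p' q'] [/= q0' yE]] := fracP y.
  rewrite (vE x (p, q)) // (vE y (p', q')) // (vE _ (p * q' - p' * q, q * q')) /=; last first.
    by split; rewrite /= !(evB, evM) ?mulf_neq0 // xE yE; field; rewrite ?q0 ?q0' ?p0.
  by rewrite evB !evM; field; rewrite !ev_eq0 ?q0 ?q0'.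
have vM : monoid_morphism v.
  split=> [|x y].
    rewrite (vE _ (1, 1)) /= ?ev1 ?divr1 //.
    by split; rewrite /= ev1 ?oner_neq0 // divr1.
  have [[p q] [/= q0 xE]] := fracP x; have [[p' q'] [/= q0' yE]] := fracP y.
  rewrite (vE x (p, q)) // (vE y (p', q')) // (vE _ (p * p', q * q')) /=; last first.
    by split; rewrite /= !evM ?mulf_neq0 // xE yE; field; rewrite ?q0 ?q0' ?p0.
  by rewrite !evM; field; rewrite !ev_eq0 ?q0 ?q0'.
pose vZ := GRing.isZmodMorphism.Build _ _ v vB.
pose vR := GRing.isMonoidMorphism.Build _ _ v vM.
pose vr : {rmorphism gen_field S -> F} := HB.pack v vZ vR.
exists vr => x p xE.
rewrite [LHS](vE x (p, 1)) /= ?ev1 ?divr1 //.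
by split; rewrite /= ev1 ?oner_neq0 // divr1.
Qed.

End Conjugation.

(** These are rescaled Chebyshev polynomials. The recurrence [2 cos ((j + 2) x) = 2 cos x * 2 cos
    ((j + 1) x) - 2 cos (j x)] has order two, so the induction carries two consecutive ones. *)
Lemma cos_multiple_poly (R : realType) (j : nat) : exists p : {poly rat},
  forall x : R, 2 * cos (j%:R * x) = (map_rat R p).[2 * cos x].
Proof.
have ratE (c : rat) (x : R) : (map_rat R c%:P).[x] = ratr c by rewrite map_polyC hornerC.
suff [p [q [pE _]]] : exists p q : {poly rat}, 
    (forall x : R, 2 * cos (j%:R * x) = (map_rat R p).[2 * cos x]) /\
    (forall x : R, 2 * cos (j.+1%:R * x) = (map_rat R q).[2 * cos x]).
  by exists p.
elim: j => [|j [p [q [pE qE]]]].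
  exists 2%:P, 'X; split=> x; last by rewrite map_polyX hornerX mul1r.
  by rewrite ratE mul0r cos0 rmorph_nat mulr1.
exists q, ('X * q - p); split=> // x.
rewrite rmorphB rmorphM /= map_polyX !hornerE -pE -qE.
have -> : j.+2%:R * x = j.+1%:R * x + x by rewrite -[j.+2%:R]natr1; ring.
have -> : j%:R * x = j.+1%:R * x - x by rewrite -[j.+1%:R]natr1; ring.
by rewrite cosD cosB; ring.
Qed.

(** * Real places of the triangle field *)

Section Angles.
Variable R : realType.

Definition angle (s : \bar int) : R := if s is n%:E then pi / n%:~R else 0.

(* An infinite entry has denominator 1: it imposes no coprimality condition. *)
Definition den (s : \bar int) : nat := if s is n%:E then `|n|%N else 1.

Lemma den_gt0 s : (2%:E <= s)%E -> (0 < den s)%N.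
Proof. by case: s => [n| |] //=; rewrite lee_fin; lia. Qed.

Lemma angle_den n : (2%:E <= n%:E)%E -> angle n%:E = pi / (den n%:E)%:R.
Proof.
rewrite lee_fin => n2; have n0 : 0 <= n by lia.
by rewrite /= natr_absz ger0_norm.
Qed.

Lemma lambda_angle s : (2%:E <= s)%E -> lambda R s = 2 * cos (2 * angle s).
Proof.
by case: s => [n| |] //= _; [rewrite mulrA | rewrite mulr0 cos0 mulr1].
Qed.

Lemma lambda_double s : (2%:E <= s)%E -> lambda R (2%:E * s)%E = 2 * cos (angle s).
Proof.
case: s => [n| |] //=; last by rewrite cos0 mulr1.
rewrite lee_fin => n2; congr (2 * cos _).
by rewrite intrM; field; rewrite intr_eq0; lia.
Qed.

Lemma angle_multiple s M : (2%:E <= s)%E -> (0 < M)%N -> (den s %| M)%N ->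
  exists j, angle s = j%:R * (pi / M%:R).
Proof.
case: s => [n| |] // s2 M0 nM; last by exists 0; rewrite mul0r.
exists (M %/ `|n|)%N; rewrite angle_den //; rewrite /= in nM *.
have n_gt0 : (0 < `|n|)%N by rewrite lee_fin in s2; lia.
have n0 : (`|n|%:R : R) != 0 by rewrite pnatr_eq0 -lt0n.
have q0 : ((M %/ `|n|)%:R : R) != 0 by rewrite pnatr_eq0 -lt0n divn_gt0 // dvdn_leq.
have : M%:R = (M %/ `|n|)%:R * `|n|%:R :> R by rewrite -natrM divnK.
move: n0 q0; move: (_ %/ _)%:R (`|n|%:R) (M%:R) => q u w u0 q0 ->.
by field; rewrite u0 q0.
Qed.

(** All generators of the field are rational polynomials in [2 cos (pi / M)]. Replacing this number
    by its conjugate [2 cos (k pi / M)] multiplies every angle by [k]. *)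
Lemma conjugate_place (a b c : \bar int) (k : nat) :
  (2%:E <= a)%E -> (2%:E <= b)%E -> (2%:E <= c)%E ->
  coprime k (2 * (den a * den b * den c)) ->
  exists v : {rmorphism triangle_field R a b c -> R},
  [/\ v (lambda_a R a b c) = 2 * cos (2 * (k%:R * angle a)),
      v (lambda_b R a b c) = 2 * cos (2 * (k%:R * angle b)),
      v (lambda_c R a b c) = 2 * cos (2 * (k%:R * angle c)) &
      v (lambda_2abc R a b c) = 2 * cos (k%:R * angle a) *
        (2 * cos (k%:R * angle b)) * (2 * cos (k%:R * angle c))].
Proof.
move=> a2 b2 c2; set M := (den a * den b * den c)%N => kM.
have M0 : (0 < M)%N by rewrite !muln_gt0 !den_gt0.
pose x : R := pi / M%:R; pose t : R := 2 * cos x; pose t' : R := 2 * cos (k%:R * x).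
have [ja aE] : exists j, angle a = j%:R * x.
  by apply: angle_multiple => //; rewrite /M -mulnA dvdn_mulr.
have [jb bE] : exists j, angle b = j%:R * x.
  by apply: angle_multiple => //; rewrite /M mulnAC dvdn_mull.
have [jc cE] : exists j, angle c = j%:R * x.
  by apply: angle_multiple => //; rewrite /M dvdn_mull.
have cosP (j : nat) : exists p, 2 * cos (j%:R * x) = (map_rat R p).[t] /\
    2 * cos (k%:R * (j%:R * x)) = (map_rat R p).[t'].
  by have [p pE] := cos_multiple_poly R j; exists p; split; [|rewrite mulrCA]; apply: pE.
have [pa [pat pat']] := cosP ja; have [pb [pbt pbt']] := cosP jb.
have [pc [pct pct']] := cosP jc.
have cos2P j : exists p, 2 * cos (2 * (j%:R * x)) = (map_rat R p).[t] /\
    2 * cos (2 * (k%:R * (j%:R * x))) = (map_rat R p).[t'].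
  have [p [pE pE']] := cosP (2 * j)%N; exists p; rewrite -pE -pE' natrM.
  by split; congr (2 * cos _); ring.
have [qa [qat qat']] := cos2P ja; have [qb [qbt qbt']] := cos2P jb.
have [qc [qct qct']] := cos2P jc.
have prodE u : (map_rat R (pa * pb * pc)).[u] =
  (map_rat R pa).[u] * (map_rat R pb).[u] * (map_rat R pc).[u].
  by rewrite !rmorphM !hornerM.
have gens y : @triangle_gens R a b c y -> exists p, y = (map_rat R p).[t].
  case=> ->.
  - by exists qa; rewrite -qat -aE lambda_angle.
  - by exists qb; rewrite -qbt -bE lambda_angle.
  - by exists qc; rewrite -qct -cE lambda_angle.
  exists (pa * pb * pc); rewrite prodE -pat -pbt -pct -aE -bE -cE.
  by rewrite /lambda_prod !lambda_double.
have [v vE] := conjugate_embedding (fun p => conjugate_cos R p M0 kM) gens.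
exists v; split.
- by rewrite (vE _ qa) /= ?lambda_angle ?aE.
- by rewrite (vE _ qb) /= ?lambda_angle ?bE.
- by rewrite (vE _ qc) /= ?lambda_angle ?cE.
rewrite (vE _ (pa * pb * pc)) /=; first by rewrite prodE -pat' -pbt' -pct' aE bE cE.
by rewrite prodE -pat -pbt -pct -aE -bE -cE /lambda_prod !lambda_double.
Qed.

End Angles.

(** The expression is a quarter of the conjugate of [triangle_beta]. Both factors of its
    factorization have the form [cos u + cos v] with [u, v >= 0] and [u + v < pi], after replacing
    [x - y] by its absolute value, which is at most [x + y]. *)
Lemma beta_factor_gt0 (R : realType) (x y z : R) :
  0 <= x -> 0 <= y -> 0 <= z -> x + y + z < pi ->
  0 < cos x ^+ 2 + cos y ^+ 2 + cos z ^+ 2 + 2 * cos x * cos y * cos z - 1.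
Proof.
move=> x0 y0 z0 xyz.
have -> : cos x ^+ 2 + cos y ^+ 2 + cos z ^+ 2 + 2 * cos x * cos y * cos z - 1 =
    (cos z + cos (x + y)) * (cos z + cos (x - y)).
  rewrite cosD cosB; have := cos2Dsin2 x; have := cos2Dsin2 y.
  move=> /(congr1 (fun u => u - cos y ^+ 2)); rewrite addrAC subrr add0r => sy.
  move=> /(congr1 (fun u => u - cos x ^+ 2)); rewrite addrAC subrr add0r => sx.
  have -> : (cos z + (cos x * cos y - sin x * sin y)) *
    (cos z + (cos x * cos y + sin x * sin y)) =
    (cos z + cos x * cos y) ^+ 2 - sin x ^+ 2 * sin y ^+ 2 by ring.
  by rewrite sx sy; ring.
have cos_gt u v : 0 <= u -> 0 <= v -> u + v < pi -> 0 < cos u + cos v.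
  move=> u0 v0 uv; have : cos (pi - u) < cos v.
    by rewrite ltr_cos ?in_itv /=; lra.
  by rewrite addrC cosDpi cosN; lra.
rewrite mulr_gt0 //; first by apply: cos_gt; lra.
rewrite -[cos (x - y)]cos_norm; apply: cos_gt => //.
have : `|x - y| <= x + y by rewrite ler_norml; lra.
lra.
Qed.

(** * Splitting of quaternion algebras *)

(** Entrywise application of [v] carries matrix units to matrix units. This settles the case
    [b = oo]. *)
Lemma matrix_splits (E R : fieldType) (v : {rmorphism E -> R}) : splits_at 'M[E]_2 v.
Proof.
pose f : 'M[E]_2 -> 'M[R]_2 := map_mx v.
have fB : zmod_morphism f by move=> A B; rewrite /f map_mxB.
have fM : monoid_morphism f by split=> [|A B]; rewrite /f ?map_mx1 ?map_mxM.
have fZ : scalable_for (v \; *:%R) f by move=> k A; rewrite /f map_mxZ.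
pose f1 := GRing.isZmodMorphism.Build _ _ f fB.
pose f2 := GRing.isMonoidMorphism.Build _ _ f fM.
pose f3 := GRing.isScalable.Build _ _ _ _ f fZ.
pose g : {lrmorphism 'M[E]_2 -> 'M[R]_2 | v \; *:%R} := HB.pack f f1 f2 f3.
pose e (F : fieldType) (i : 'I_(2 * 2)) : 'M[F]_2 := vec_mx (delta_mx ord0 i).
have eP F : is_basis (@e F).
  have eE (c : 'rV[F]_(2 * 2)) : \sum_i c ord0 i *: e F i = vec_mx c.
    by rewrite [in RHS](row_sum_delta c) linear_sum; apply: eq_bigr => i _; rewrite linearZ.
  by exists mxvec => c; rewrite eE ?vec_mxK ?mxvecK.
exists g, (2 * 2)%N, (e E); split; first exact: eP.
have -> : g \o e E = e R; last exact: eP.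
by apply/funext => i; rewrite /= /f /e map_vec_mx map_delta_mx.
Qed.

Section Mx2.
Variable F : fieldType.

Definition mx2 (p q r s : F) : 'M[F]_2 :=
  \matrix_(i, j) (nth [::] [:: [:: p; q]; [:: r; s]] i)`_j.

Lemma mx2P (A B : 'M[F]_2) :
  [/\ A 0 0 = B 0 0, A 0 1 = B 0 1, A 1 0 = B 1 0 & A 1 1 = B 1 1] -> A = B.
Proof.
move=> [h00 h01 h10 h11]; apply/matrixP => i j.
have ord2 (k : 'I_2) : k = 0 \/ k = 1.
  by case: k => -[|[|k]] // hk; [left|right]; apply: val_inj.
by case: (ord2 i) => ->; case: (ord2 j) => ->.
Qed.

End Mx2.

(** A square root [s] of [v y] gives explicit matrices for the generators; the standard basis goes
    to a basis because 2, [s] and [v x] are invertible. *)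
Lemma quaternion_splits (E R : fieldType) (v : {rmorphism E -> R}) (x y : E) (s : R) :
  2 != 0 :> R -> x != 0 -> y != 0 -> v y = s ^+ 2 -> splits_at (quaternion x y) v.
Proof.
move=> two0 x0 y0 ys; pose x' := v x.
have x'0 : x' != 0 by rewrite fmorph_eq0.
have s0 : s != 0 by apply: contra_neq y0 => s0; apply/eqP; rewrite -(fmorph_eq0 v) ys s0 expr0n.
(* i |-> [[0, x'], [1, 0]] and j |-> diag (s, - s) *)
pose g (p q r t : R) := mx2 (p + s * r) (x' * (q - s * t)) (q + s * t) (p - s * r).
pose f (u : quaternion x y) : 'M[R]_2 := 
  g (v (quat_coord u 0)) (v (quat_coord u 1)) (v (quat_coord u 2)) (v (quat_coord u 3)).
have fB : zmod_morphism f.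
  move=> u w; rewrite /f -scaleN1r !quat_coordD !quat_coordZ !rmorphD !rmorphM !rmorphN1.
  by apply: mx2P; rewrite !mxE /=; split; ring.
have fM : monoid_morphism f.
  split.
    rewrite /f quat_1E !quat_coordE //= rmorph0 rmorph1.
    by apply: mx2P; rewrite !mxE /=; split; ring.
  move=> u w; rewrite /f quat_mulE /quat_mul !quat_coordE //=.
  rewrite !(rmorphD, rmorphN, rmorphM) /= ys -/x'.
  by apply: mx2P; rewrite !mxE !big_ord_recl !big_ord0 !mxE /=; split; ring.
have fZ : scalable_for (v \; *:%R) f.
  move=> k u; rewrite /f !quat_coordZ !rmorphM /=.
  by apply: mx2P; rewrite !mxE /=; split; ring.
pose f1 := GRing.isZmodMorphism.Build _ _ f fB.
pose f2 := GRing.isMonoidMorphism.Build _ _ f fM.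
pose f3 := GRing.isScalable.Build _ _ _ _ f fZ.
pose h : {lrmorphism quaternion x y -> 'M[R]_2 | v \; *:%R} := HB.pack f f1 f2 f3.
pose e (i : 'I_4) : quaternion x y := delta_mx ord0 i.
exists h, 4, e; split.
  have eE (c : 'rV[E]_4) : \sum_i c ord0 i *: e i = c by rewrite [RHS]row_sum_delta.
  by exists id => c; rewrite eE.
have fe (c : 'rV[R]_4) : \sum_i c ord0 i *: (h \o e) i =
    g (c 0 (inord 0)) (c 0 (inord 1)) (c 0 (inord 2)) (c 0 (inord 3)).
  have eE (i : 'I_4) (l : nat) : quat_coord (e i) l = (i == inord l)%:R.
    by rewrite /quat_coord mxE eqxx eq_sym.
  have i4 : [/\ ord0 = inord 0 :> 'I_4, lift ord0 ord0 = inord 1 :> 'I_4,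
     lift ord0 (lift ord0 ord0) = inord 2 :> 'I_4 & 
     lift ord0 (lift ord0 (lift ord0 ord0)) = inord 3 :> 'I_4].
    by split; apply: val_inj; rewrite /= inordK.
  have [i0 i1 i2 i3] := i4.
  rewrite !big_ord_recl big_ord0 /= /f !eE i3 i2 i1 i0.
  rewrite -!val_eqE /= !inordK //= !rmorph_nat.
  by apply: mx2P; rewrite !mxE /=; split; ring.
(* This is the solution of [g p q r t = A]: the diagonal determines [p] and [r], the off-diagonal
   entries determine [q] and [t]. *)
exists (fun A : 'M[R]_2 => \row_(j < 4) [:: (A 0 0 + A 1 1) / 2; (A 1 0 + A 0 1 / x') / 2;
   (A 0 0 - A 1 1) / (2 * s); (A 1 0 - A 0 1 / x') / (2 * s)]`_j) => [c|A].
  rewrite fe; apply/rowP => j; rewrite !mxE /= -[in RHS](inord_val j).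
  by case: j => -[|[|[|[|j]]]] //= hj; field; rewrite ?two0 ?s0 ?x'0.
rewrite fe !mxE !inordK //=; apply: mx2P; rewrite !mxE /=.
by split; field; rewrite ?two0 ?s0 ?x'0.
Qed.

Lemma cos_double (R : realType) (x : R) : cos (2 * x) = 2 * cos x ^+ 2 - 1.
Proof. by rewrite [2 * x]mulr_natl cos_mulr2n; ring. Qed.

(** It splits the [match] on [b] in [triangle_algebra] without replacing [b] in the field over which
    both branches are algebras. *)
Lemma if_fin (T : Type) (s : \bar int) (x y : T) (P : T -> Prop) :
  (forall m, s = m%:E -> P x) -> (~~ (s \is a fin_num) -> P y) ->
  P (if s is _%:E then x else y).
Proof. by case: s => [m| |] Px Py; [apply: (Px m)|apply: Py|apply: Py]. Qed.

(** * Split places of the triangle algebra *)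

Section Splitting.
Variables (R : realType) (a b c : \bar int).
Hypothesis abc : hyperbolic_triple a b c.

Lemma hyperbolic_ge2 : [/\ (2%:E <= a)%E, (2%:E <= b)%E & (2%:E <= c)%E].
Proof.
have [a2 ab bc _] := abc; have b2 := le_trans a2 ab.
by split=> //; apply: le_trans b2 bc.
Qed.

(** If [b = 2], then [a = 2] and the hyperbolicity condition becomes [1/c < 0]. *)
Lemma hyperbolic_ge3 : (3%:E <= b)%E.
Proof.
have [a2 b2 c2] := hyperbolic_ge2; have [_ ab bc] := abc.
move: abc => [_ _ _]; case: b ab bc b2 => [m| |] //= ab bc; rewrite !lee_fin => m2 H _.
rewrite leNgt; apply/negP => m3; have mE : m = 2 by lia.
move: H; rewrite {}mE {m2 m3} in ab *.
case: a ab a2 => [n| |] //=; rewrite !lee_fin => nm n2; have -> : n = 2 by lia.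
rewrite (_ : 2%:~R^-1 + 2%:~R^-1 = 1 :> rat) //.
case: c c2 => [p| |] //= p2.
have : 0 <= p%:~R^-1 :> rat by rewrite lee_fin in p2; rewrite invr_ge0 ler0z; lia.
by rewrite leNgt addrAC subrr add0r => /negP.
Qed.

Lemma angle_ge0 s : (2%:E <= s)%E -> 0 <= angle R s.
Proof.
case: s => [n| |] //=; rewrite lee_fin => n2.
by rewrite divr_ge0 ?pi_ge0 // ler0z; lia.
Qed.

Lemma angle_gt0 s : (2%:E <= s)%E -> s != +oo%E -> 0 < angle R s.
Proof.
case: s => [n| |] //=; rewrite lee_fin => n2 _.
by rewrite divr_gt0 ?pi_gt0 // ltr0z; lia.
Qed.

Lemma small_angle s (k m : nat) : (2%:E <= s)%E -> (0 < m)%N ->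
  (s != +oo%E -> (k * m < den s)%N) -> k%:R * angle R s < pi / m%:R.
Proof.
move=> s2 m0; have pi0 := pi_gt0 R.
case: s s2 => [n| |] // s2 ks; last by rewrite mulr0 divr_gt0 ?ltr0n.
have := ks isT; have := den_gt0 s2; rewrite angle_den //.
move: (den _) => d d0 kd; rewrite mulrCA ltr_pM2l //.
by rewrite ltr_pdivrMr ?ltr0n // mulrC ltr_pdivlMr ?ltr0n // -natrM ltr_nat.
Qed.

Lemma angle_le s (n : nat) : (0 < n)%N -> (n%:~R%:E <= s)%E -> (2%:E <= s)%E ->
  angle R s <= pi / n%:R.
Proof.
move=> n0; have pi0 := pi_gt0 R.
case: s => [m| |] // nm m2; last by rewrite /= divr_ge0 ?ler0n ?(ltW pi0).
rewrite angle_den //= ler_pM2l // lef_pV2 ?posrE ?ltr0n ?ler_nat //.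
all: rewrite !lee_fin in nm m2; lia.
Qed.

Lemma cos_angle_mod s (k : nat) : (2%:E <= s)%E -> (k = 1 %[mod 2 * den s])%N ->
  cos (k%:R * angle R s) = cos (angle R s).
Proof.
case: s => [n| |] // s2 k1; last by rewrite mulr0.
have d0 := den_gt0 s2; rewrite angle_den //; move: (den _) d0 k1 => d d0.
rewrite [(1 %% _)%N]modn_small; last by lia.
move=> k1; rewrite (divn_eq k (2 * d)) k1; move: (k %/ _)%N => q.
have -> : (q * (2 * d) + 1)%:R * (pi / d%:R) = pi / d%:R + (pi *+ 2) *+ q :> R.
  rewrite natrD !natrM -[pi *+ 2 *+ q]mulr_natl -[pi *+ 2]mulr_natl.
  by field; rewrite pnatr_eq0; lia.
by rewrite (periodicn (@cosD2pi R)).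
Qed.

Let E := triangle_field R a b c.

(** The condition is on cosines only: a multiple [k pi / s] may be large, yet have the cosine of a
    small angle, as when [k = 1] modulo [2s]. *)
Definition split_index (k : nat) : Prop :=
  exists x y z : R,
    [/\ [/\ 0 <= x, 0 <= y & 0 <= z], x + y + z < pi,
        cos (k%:R * angle R a) = cos x, cos (k%:R * angle R b) = cos y &
        cos (k%:R * angle R c) = cos z].

Lemma lambda_add2_gt0 s : (3%:E <= s)%E -> 0 < 2 * cos (2 * angle R s) + 2.
Proof.
move=> s3; have s2 : (2%:E <= s)%E by apply: le_trans s3; rewrite lee_fin.
have w0 := angle_ge0 s2; have pi0 := pi_gt0 R.
have w3 : angle R s <= pi / 3%:R by apply: angle_le.
have c0 : 0 < cos (angle R s) by apply: cos_gt0_pihalf; lra.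
have -> : 2 * cos (2 * angle R s) + 2 = 4 * cos (angle R s) ^+ 2.
  by rewrite cos_double; ring.
by rewrite mulr_gt0 // exprn_gt0.
Qed.

(** For finite [b], the second entry of the Hilbert symbol becomes positive at [v], hence a square
    in [R]. *)
Lemma triangle_algebra_splits k (v : {rmorphism E -> R}) :
  split_index k ->
  v (lambda_a R a b c) = 2 * cos (2 * (k%:R * angle R a)) ->
  v (lambda_b R a b c) = 2 * cos (2 * (k%:R * angle R b)) ->
  v (lambda_c R a b c) = 2 * cos (2 * (k%:R * angle R c)) ->
  v (lambda_2abc R a b c) = 2 * cos (k%:R * angle R a) *
        (2 * cos (k%:R * angle R b)) * (2 * cos (k%:R * angle R c)) ->
  splits_at (triangle_algebra R a b c) v.
Proof.
move=> sk va vb vc vabc; have [a2 b2 c2] := hyperbolic_ge2.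
have b3 := hyperbolic_ge3; have [_ ab bc _] := abc.
apply: (@if_fin _ b _ _ (fun A => splits_at A v)); last by move=> _; apply: matrix_splits.
move=> m bE; have [x [y [z [[x0 y0 z0] xyz ka kb kc]]]] := sk.
have c3 : (3%:E <= c)%E by apply: le_trans b3 bc.
(* Elements of [E] are shown to be nonzero by evaluation at [u], the place [k = 1], where the angles
   of [b] and [c] are at most [pi / 3]. *)
have [u [_ ub uc _]] := conjugate_place R a2 b2 c2 (coprime1n _).
rewrite mul1r in ub; rewrite mul1r in uc.
have lb0 : lambda_b R a b c + 2 != 0.
  by rewrite -(fmorph_eq0 u) rmorphD rmorph_nat ub gt_eqF // lambda_add2_gt0.
have lc0 : lambda_c R a b c + 2 != 0.
  by rewrite -(fmorph_eq0 u) rmorphD rmorph_nat uc gt_eqF // lambda_add2_gt0.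
have cos2P w : 2 * cos (2 * w) + 2 = 4 * cos w ^+ 2 :> R.
  by rewrite cos_double; ring.
(* At [v] this factor is [4 cos^2], hence nonnegative; it does not vanish because it is already
   nonzero in [E]. *)
have vb0 : 0 < v (lambda_b R a b c + 2).
  rewrite lt0r fmorph_eq0 lb0 /= rmorphD rmorph_nat vb cos2P.
  by rewrite mulr_ge0 // sqr_ge0.
have vc0 : 0 < v (lambda_c R a b c + 2).
  rewrite lt0r fmorph_eq0 lc0 /= rmorphD rmorph_nat vc cos2P.
  by rewrite mulr_ge0 // sqr_ge0.
have vbeta : 0 < v (triangle_beta R a b c).
  rewrite /triangle_beta 4!rmorphD rmorph_nat va vb vc vabc.
  rewrite !cos_double ka kb kc.
  have := beta_factor_gt0 x0 y0 z0 xyz; lra.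
set Y := (X in quaternion _ X).
have vY : 0 < v Y by rewrite /Y !rmorphM !mulr_gt0.
apply: (@quaternion_splits _ _ _ _ _ (Num.sqrt (v Y))); last by rewrite sqr_sqrtr // ltW.
- by rewrite pnatr_eq0.
- have -> : lambda_b R a b c ^+ 2 - 4 = (lambda_b R a b c - 2) * (lambda_b R a b c + 2) by ring.
  rewrite mulf_neq0 // -(fmorph_eq0 u) rmorphB rmorph_nat ub lt_eqF // subr_lt0.
  have pi0 := pi_gt0 R.
  have w0 : 0 < angle R b by apply: angle_gt0; rewrite // bE.
  have w3 : angle R b <= pi / 3%:R by apply: angle_le.
  have : cos (2 * angle R b) < cos 0 by rewrite ltr_cos ?in_itv /=; lra.
  by rewrite cos0; lra.
- by rewrite -(fmorph_eq0 v) gt_eqF.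
Qed.

(** The [r + 1] places obtained from [s] are distinct: they send the generator attached to [d] to
    [2 cos (2 k pi / d)], and [2k < d] keeps these angles in [[0, pi)], where the cosine is
    injective. *)
Lemma many_split_places (r : nat) (d : \bar int) (s : seq nat) :
  d \in [:: a; b; c] -> d != +oo%E -> uniq s -> size s = r.+1 ->
  {in s, forall k, [/\ coprime k (2 * (den a * den b * den c)), split_index k &
    (2 * k < den d)%N]} -> ~ adim_eq R a b c r.
Proof.
move=> dabc d_fin us ss Hs; have [a2 b2 c2] := hyperbolic_ge2.
have d2 : (2%:E <= d)%E by move: dabc; rewrite !inE => /or3P[]/eqP->.
have [ld ldP] : exists l : E, forall v : {rmorphism E -> R}, forall k : nat, 
    [/\ v (lambda_a R a b c) = 2 * cos (2 * (k%:R * angle R a)),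
      v (lambda_b R a b c) = 2 * cos (2 * (k%:R * angle R b)) &
      v (lambda_c R a b c) = 2 * cos (2 * (k%:R * angle R c))] ->
      v l = 2 * cos (2 * (k%:R * angle R d)).
  move: dabc; rewrite !inE => /or3P[]/eqP->.
  - by exists (lambda_a R a b c) => v k [].
  - by exists (lambda_b R a b c) => v k [].
  - by exists (lambda_c R a b c) => v k [].
have place i : exists v : {rmorphism E -> R}, (i < r.+1)%N ->
    splits_at (triangle_algebra R a b c) v /\
    v ld = 2 * cos (2 * ((nth 0%N s i)%:R * angle R d)).
  (* Beyond the range of [s] the place [k = 1] serves as a default, so that [choice] applies to all
     [i]. *)
  have [ir|ir] := ltnP i r.+1; last first.
    by have [u _] := conjugate_place R a2 b2 c2 (coprime1n _); exists u.
  have [|kc ks _] := Hs (nth 0%N s i); first by rewrite mem_nth ?ss.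
  have [v [va vb vc vabc]] := conjugate_place R a2 b2 c2 kc.
  exists v => _; split; first exact: (triangle_algebra_splits ks).
  exact: ldP.
have [f fP] := choice place.
have s_small i : (i < r.+1)%N ->
    0 <= (nth 0%N s i)%:R * angle R d < pi / 2%:R.
  move=> ir; have [|_ _ sd] := Hs (nth 0%N s i); first by rewrite mem_nth ?ss.
  by rewrite mulr_ge0 ?angle_ge0 //= small_angle // mulnC.
have d0 : angle R d != 0 by rewrite gt_eqF // angle_gt0.
have f_inj : {in [set i | (i < r.+1)%N] &, injective f}.
  move=> i j /set_mem ir /set_mem jr eij; have [_ ei] := fP i ir; have [_ ej] := fP j jr.
  rewrite eij ej in ei; have := s_small i ir; have := s_small j jr; have pi0 := pi_gt0 R.
  move=> sj si; have cE : cos (2 * ((nth 0%N s i)%:R * angle R d)) =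
    cos (2 * ((nth 0%N s j)%:R * angle R d)) by lra.
  have {}cE := cos_inj _ _ cE; rewrite !in_itv /= in cE.
  have /mulfI/(mulIf d0)/eqP : 2 * ((nth 0%N s i)%:R * angle R d) =
    2 * ((nth 0%N s j)%:R * angle R d) by apply: cE; lra.
  by rewrite eqr_nat nth_uniq ?ss // => H; apply/eqP/H; rewrite ?pnatr_eq0.
rewrite /adim_eq => adim.
have : ([set f i | i in [set i | (i < r.+1)%N]] #<= @split_real_places R a b c)%card.
  by apply: subset_card_le => _ [i ir <-]; have [] := fP i ir.
by rewrite (card_le_eqr adim) (card_le_eql (inj_card_eq f_inj)) card_le_II ltnn.
Qed.

End Splitting.

(** * Bounds on the entries *)

(** Since [Y < 6 m (X + 1)] and [m^2 <= Y], first [m < 6 (X + 1)] and then [Y < 36 (X + 1)^2];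
    finally [X + 1 <= 2 X]. *)
Lemma quotient_bounds (q m Y Z : nat) : (q <= 6)%N -> (0 < q)%N -> (0 < m)%N ->
  (12 <= Z)%N -> (m ^ 2 <= Y)%N -> (36 * Z ^ 2 <= Y)%N ->
  let X := (Y %/ (q * m))%N in (Z <= X)%N /\ (m * Y <= (12 * X) ^ 3)%N.
Proof.
move=> q6 q0 m0 Z12 mY ZY X.
have YX : (Y < 6 * m * X.+1)%N.
  have : (Y < X.+1 * (q * m))%N by rewrite -ltn_divLR ?muln_gt0 ?q0.
  by move=> h; apply: (leq_trans h); rewrite mulnC leq_mul2r leq_mul2r q6 !orbT.
have mX : (m < 6 * X.+1)%N.
  have : (m * m < m * (6 * X.+1))%N by rewrite mulnn (leq_ltn_trans mY) // mulnCA mulnA.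
  by rewrite ltn_mul2l => /andP[].
have YX2 : (Y < 36 * X.+1 ^ 2)%N.
  by apply: leq_trans YX _; rewrite -[36%N]/(6 * 6)%N -!mulnA -mulnn; nia.
have ZX : (Z <= X)%N.
  by move: (leq_ltn_trans ZY YX2); rewrite ltn_mul2l /= ltn_sqr.
split=> //; apply: (@leq_trans ((6 * X.+1) ^ 3)).
  rewrite [in leqRHS]expnS; apply: leq_mul; first exact: ltnW.
  by apply: leq_trans (ltnW YX2) _; rewrite expnMn.
by apply: leq_exp2rW; lia.
Qed.

Lemma den_le s t : (2%:E <= s)%E -> (s <= t)%E -> t != +oo%E -> (den s <= den t)%N.
Proof.
by case: s t => [m| |] [n| |] //=; rewrite !lee_fin; lia.
Qed.

Section Bound.
Variables (R : realType) (r Z : nat).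
Hypothesis Z12 : (12 <= Z)%N.
Hypothesis many_coprime : forall X n m, (Z <= X)%N -> (0 < n)%N -> (0 < m)%N ->
  (n <= X ^ 18)%N -> exists s : seq nat, [/\ uniq s, size s = r.+1 &
    {in s, forall k, [/\ k = 1 %[mod m], coprime k n & k < m * X]%N}].

Variables a b c : \bar int.
Hypothesis abc : hyperbolic_triple a b c.
Hypothesis adim : adim_eq R a b c r.

Let A := den a.
Let B := den b.
Let C := den c.

Let a2 : (2%:E <= a)%E. Proof. by have [] := hyperbolic_ge2 abc. Qed.
Let b2 : (2%:E <= b)%E. Proof. by have [] := hyperbolic_ge2 abc. Qed.
Let c2 : (2%:E <= c)%E. Proof. by have [] := hyperbolic_ge2 abc. Qed.
Let A0 : (0 < A)%N. Proof. exact: den_gt0. Qed.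
Let B0 : (0 < B)%N. Proof. exact: den_gt0. Qed.
Let C0 : (0 < C)%N. Proof. exact: den_gt0. Qed.
Let n0 : (0 < 2 * (A * B * C))%N. Proof. by rewrite !muln_gt0 A0 B0 C0. Qed.

(** Each of the three cases bounds [2abc] by [(12 X)^9]; as [12 <= Z <= X], this is the source of
    the exponent 18 in [many_coprime]. *)
Let pow_bound X n : (Z <= X)%N -> (n <= (12 * X) ^ 9)%N -> (n <= X ^ 18)%N.
Proof.
move=> ZX nX; apply: leq_trans nX _; rewrite -[18%N]/(2 * 9)%N expnM.
by apply: leq_exp2rW; rewrite -mulnn leq_mul2r (leq_trans Z12) ?orbT.
Qed.

(** The congruence modulo [2AB] fixes the cosines at [a] and [b], so only the angle at [c] moves.
    The divisor 6 comes from [pi/2 + pi/3 + pi/6 = pi]. *)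
Lemma den_bound_large_c : c != +oo%E -> ((2 * (A * B)) ^ 2 <= C)%N -> (C < 36 * Z ^ 2)%N.
Proof.
move=> c_fin mC; rewrite ltnNge; apply/negP => ZC; set m := (2 * (A * B))%N in mC.
have m0 : (0 < m)%N by rewrite /m !muln_gt0 A0 B0.
have [ZX nX] := quotient_bounds (leqnn 6) isT m0 Z12 mC ZC.
set X := (C %/ (6 * m))%N in ZX nX.
have X0 : (0 < 12 * X)%N by lia.
have nX18 : (2 * (A * B * C) <= X ^ 18)%N.
  apply: pow_bound => //; rewrite mulnA; apply: leq_trans nX _.
  by rewrite leq_pexp2l.
have [s [us ss Hs]] := many_coprime ZX n0 m0 nX18.
have kC k : (k < m * X -> k * 6 < C)%N.
  move=> kX; apply: leq_trans (leq_trunc_div C (6 * m)); rewrite -/X.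
  by have -> : (X * (6 * m) = m * X * 6)%N; [lia | rewrite ltn_mul2r kX].
apply: (many_split_places abc (d := c) _ c_fin us ss _ adim).
  by rewrite !inE eqxx !orbT.
move=> k /Hs[k1 kn /kC k6].
split; [exact: kn| |by apply: leq_ltn_trans k6; rewrite mulnC leq_mul].
exists (angle R a), (angle R b), (k%:R * angle R c).
have kmod s0 : (den s0 %| A * B)%N -> (k = 1 %[mod 2 * den s0])%N.
  by move=> dm; rewrite -(@modn_dvdm m) ?dvdn_mul // k1 modn_dvdm ?dvdn_mul.
have xa : angle R a <= pi / 2%:R by apply: angle_le.
have xb : angle R b <= pi / 3%:R by apply: angle_le => //; apply: hyperbolic_ge3 abc.
have xc : k%:R * angle R c < pi / 6%:R by apply: small_angle.
have ka : (k = 1 %[mod 2 * den a])%N by apply: kmod; apply: dvdn_mulr.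
have kb : (k = 1 %[mod 2 * den b])%N by apply: kmod; apply: dvdn_mull.
split; [|lra|exact: cos_angle_mod|exact: cos_angle_mod|by []].
by rewrite mulr_ge0 ?angle_ge0.
Qed.

Hypothesis C_small : (C <= (2 * (A * B)) ^ 2)%N.

Let n_le : (2 * (A * B * C) <= (2 * (A * B)) ^ 3)%N.
Proof. by rewrite mulnA [in leqRHS]expnS leq_mul2l C_small orbT. Qed.

(** Now the angles at [b] and [c] both move; since [b <= c], a bound on [k] in terms of [b] controls
    both. The divisor 4 comes from [pi/2 + pi/4 + pi/4 = pi]. *)
Lemma den_bound_large_b : b != +oo%E -> ((2 * A) ^ 2 <= B)%N -> (B < 36 * Z ^ 2)%N.
Proof.
move=> b_fin mB; rewrite ltnNge; apply/negP => ZB; set m := (2 * A)%N in mB.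
have m0 : (0 < m)%N by rewrite /m !muln_gt0 A0.
have [ZX nX] := @quotient_bounds 4 m B Z isT isT m0 Z12 mB ZB.
set X := (B %/ (4 * m))%N in ZX nX.
have nX18 : (2 * (A * B * C) <= X ^ 18)%N.
  apply: pow_bound => //; apply: leq_trans n_le _.
  by rewrite -[9%N]/(3 * 3)%N expnM mulnA; apply: leq_exp2rW.
have [s [us ss Hs]] := many_coprime ZX n0 m0 nX18.
have kB k : (k < m * X -> k * 4 < B)%N.
  move=> kX; apply: leq_trans (leq_trunc_div B (4 * m)); rewrite -/X.
  by have -> : (X * (4 * m) = m * X * 4)%N; [lia | rewrite ltn_mul2r kX].
apply: (many_split_places abc (d := b) _ b_fin us ss _ adim).
  by rewrite !inE eqxx !orbT.
move=> k /Hs[k1 kn /kB k4].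
split; [exact: kn| |by apply: leq_ltn_trans k4; rewrite mulnC leq_mul].
exists (angle R a), (k%:R * angle R b), (k%:R * angle R c).
have xa : angle R a <= pi / 2%:R by apply: angle_le.
have xb : k%:R * angle R b < pi / 4%:R by apply: small_angle.
have xc : k%:R * angle R c < pi / 4%:R.
  apply: small_angle => // c_fin; apply: leq_trans k4 _.
  by apply: den_le => //; have [] := abc.
split; [|lra|exact: cos_angle_mod|by []|by []].
by rewrite !mulr_ge0 ?angle_ge0.
Qed.

(** All three angles move and stay below [pi/3], so no congruence is imposed and the sieve is
    applied with modulus 1. Here [2AB <= (2A)^3], whence [2ABC <= (2A)^9]. *)
Lemma den_bound_large_a : a != +oo%E -> (B <= (2 * A) ^ 2)%N -> (A < 36 * Z ^ 2)%N.
Proof.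
move=> a_fin B_small; rewrite ltnNge; apply/negP => ZA.
pose X := (A %/ 3)%N.
have AX : (A < 3 * X.+1)%N by rewrite mulnC -ltn_divLR.
have ZX : (Z <= X)%N by rewrite leq_divRL //; nia.
have nX18 : (2 * (A * B * C) <= X ^ 18)%N.
  apply: pow_bound => //; apply: leq_trans n_le _.
  rewrite -[9%N]/(3 * 3)%N expnM; apply: leq_exp2rW.
  apply: (@leq_trans ((2 * A) ^ 3)); last by apply: leq_exp2rW; lia.
  by rewrite mulnA expnS leq_mul2l B_small orbT.
have [s [us ss Hs]] := many_coprime ZX n0 (ltn0Sn 0) nX18.
have kA k : (k < 1 * X -> k * 3 < A)%N.
  by rewrite mul1n => kX; apply: leq_trans (leq_trunc_div A 3); rewrite ltn_mul2r kX.
apply: (many_split_places abc (d := a) _ a_fin us ss _ adim).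
  by rewrite !inE eqxx.
move=> k /Hs[_ kn /kA k3].
split; [exact: kn| |by apply: leq_ltn_trans k3; rewrite mulnC leq_mul].
exists (k%:R * angle R a), (k%:R * angle R b), (k%:R * angle R c).
have small d : (2%:E <= d)%E -> (a <= d)%E -> k%:R * angle R d < pi / 3%:R.
  move=> d2 ad; apply: small_angle => // d_fin; apply: leq_trans k3 _.
  exact: den_le.
have [_ ab bc _] := abc.
have := small a a2 (lexx _); have := small b b2 ab; have := small c c2 (le_trans ab bc).
move=> xc xb xa; split; [|lra|by []|by []|by []].
by rewrite !mulr_ge0 ?angle_ge0.
Qed.

End Bound.

Lemma triangle_triples_bounded (R : realType) (r : nat) : exists N : nat,
  forall a b c, triangle_triples R r (a, b, c) ->
  [/\ (den a <= N)%N, (den b <= N)%N & (den c <= N)%N].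
Proof.
have [X0 coprimeX0] := many_coprime_below 18 r.+1.
(* [P] bounds [a], and also [b] or [c] when it is large compared with the preceding entries;
   otherwise [Q] bounds [b] in terms of [a], and [N] bounds [c] in terms of [a] and [b]. *)
pose Z := maxn X0 12; have [P PE] : exists P, P = (36 * Z ^ 2)%N by exists (36 * Z ^ 2)%N.
pose Q := ((2 * P) ^ 2)%N.
pose N := ((2 * (P * Q)) ^ 2)%N.
have many X n m (ZX : (Z <= X)%N) := coprimeX0 X n m (leq_trans (leq_maxl _ _) ZX).
have Z12 : (12 <= Z)%N by apply: leq_maxr.
have P0 : (0 < P)%N by rewrite PE muln_gt0 expn_gt0 (leq_trans _ Z12).
have leq_square x : (x <= x ^ 2)%N by case: x => // x; rewrite -mulnn leq_pmulr.
have PQ : (P <= Q)%N by apply: leq_trans (leq_square _); rewrite leq_pmull.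
have QN : (Q <= N)%N.
  by apply: leq_trans (leq_square _); rewrite mulnA leq_pmull // muln_gt0.
exists N => a b c [abc adim]; have [a2 b2 c2] := hyperbolic_ge2 abc.
have [_ ab bc _] := abc.
have [cmax|C_small] : (c != +oo%E /\ (2 * (den a * den b)) ^ 2 <= den c)%N \/
    (den c <= (2 * (den a * den b)) ^ 2)%N.
(* An infinite [c] has denominator 1 and so belongs to the second case. *)
- have [->|c_fin] := eqVneq c +oo%E; first by right; rewrite expn_gt0 !muln_gt0 !den_gt0.
  by case: (leqP ((2 * (den a * den b)) ^ 2) (den c)) => h; [left|right; apply: ltnW].
- have [c_fin cP] := cmax.
  have := ltnW (den_bound_large_c Z12 many abc adim c_fin cP); rewrite -PE => CP.
  have C_le := leq_trans CP (leq_trans PQ QN).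
  split=> //; apply: leq_trans C_le; apply: den_le => //.
  exact: le_trans ab bc.
suff [AP BQ] : (den a <= P)%N /\ (den b <= Q)%N.
  split; [exact: leq_trans AP (leq_trans PQ QN)|exact: leq_trans BQ QN|].
  apply: leq_trans C_small _; apply: leq_exp2rW.
  by rewrite leq_mul2l leq_mul.
have [bmax|B_small] : (b != +oo%E /\ (2 * den a) ^ 2 <= den b)%N \/
    (den b <= (2 * den a) ^ 2)%N.
- have [->|b_fin] := eqVneq b +oo%E; first by right; rewrite expn_gt0 !muln_gt0 !den_gt0.
  by case: (leqP ((2 * den a) ^ 2) (den b)) => h; [left|right; apply: ltnW].
- have [b_fin bP] := bmax.
  have := ltnW (den_bound_large_b Z12 many abc adim C_small b_fin bP); rewrite -PE => B_le.
  split; last exact: leq_trans B_le PQ.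
  by apply: leq_trans B_le; apply: den_le.
have AP : (den a <= P)%N.
  have [->|a_fin] := eqVneq a +oo%E; first exact: P0.
  rewrite PE; exact: ltnW (den_bound_large_a Z12 many abc adim C_small a_fin B_small).
by split=> //; apply: leq_trans B_small _; apply: leq_exp2rW; rewrite leq_mul2l AP orbT.
Qed.

Lemma finite_den_le (N : nat) : finite_set [set s : \bar int | (2%:E <= s)%E /\ (den s <= N)%N].
Proof.
apply: (@sub_finite_set _ _ ([set +oo%E] `|` [set (Posz n)%:E | n in `I_N.+1])%classic).
  move=> [n| |] [n2 nN] //; [right|by left].
  exists `|n|%N => //=; congr EFin.
  by rewrite lee_fin in n2; lia.
rewrite finite_setU; split; first exact: finite_set1.
apply: finite_image; exact: finite_II.
Qed.

Unset Implicit Arguments.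

Theorem theorem4p1 (R : realType) (r : nat) (hr : (1 <= r)%N) :
  finite_set (triangle_triples R r).
Proof.
have [N Nbound] := triangle_triples_bounded R r.
have fin := finite_den_le N.
apply: (sub_finite_set _ (finite_setX (finite_setX fin fin) fin)).
move=> [[a b] c] T; have [AN BN CN] := Nbound a b c T.
by have [a2 b2 c2] := hyperbolic_ge2 T.1.
Qed.
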